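(* Let $1<p<\infty$, let $r,s\in\mathbb{C}$, and let $U(s,r,s)$ be the bounded linear operator on $bv_p$ defined by the symmetric tri-band matrix with $r$ on the main diagonal and $s$ on the first super- and sub-diagonals. Then the spectrum of $U(s,r,s)$ on $bv_p$ is $$\sigma\left(U(s,r,s),bv_p\right)=[r-2s,\,r+2s],$$ where $[r-2s,r+2s]=\{r+2s\cos\theta:\theta\in[0,2\pi]\}$ is the line segment in $\mathbb{C}$ joining $r-2s$ and $r+2s$.
   Context: $\mathbb{N}=\{0,1,2,\dots\}$. $bv_p$ is the complex Banach space of all complex sequences $x=(x_k)_{k\in\mathbb{N}}$ with $\sum_k|x_k-x_{k+1}|^p<\infty$, with norm $\|x\|_{bv_p}=\left(\sum_{k=0}^\infty|x_k-x_{k-1}|^p\right)^{1/p}$, where $x_{-1}=0$. The operator $U(s,r,s)$ acts by $(U(s,r,s)x)_k=sx_{k-1}+rx_k+sx_{k+1}$ for $k\in\mathbb{N}$, with the convention $x_{-1}=0$. For a bounded linear operator $T$ on a complex Banach space $X$, a regular value is a $\lambda\in\mathbb{C}$ such that (R1) $(T-\lambda I)^{-1}$ exists (i.e. $T-\lambda I$ is injective), (R2) it is bounded, (R3) it is defined on a dense subset of $X$ (i.e. the range of $T-\lambda I$ is dense). The spectrum $\sigma(T,X)$ is the set of all $\lambda\in\mathbb{C}$ that are not regular values. *)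

(* Defs.v *)
From HB Require Import structures.
From mathcomp Require Import all_boot all_order all_algebra.
From mathcomp Require Import all_classical all_reals all_analysis.
From mathcomp Require Import complex ring.

Set Implicit Arguments.
Unset Strict Implicit.
Unset Printing Implicit Defensive.

Import Order.TTheory GRing.Theory Num.Theory.
Import numFieldNormedType.Exports.

Local Open Scope classical_set_scope.
Local Open Scope ring_scope.
Local Open Scope complex_scope.

Section spectrum.
Context {R : realType} {X : normedModType R[i]}.
Implicit Types (T : {linear X -> X}) (l : R[i]).

Definition resolvent_op T l : X -> X := fun x => T x - l *: x.

(* Given injectivity, a left inverse [g] of [resolvent_op T l] restricts to
   (T - l I)^-1 on the range; its values off the range are irrelevant. *)
Definition regular_value T l : Prop :=
  [/\ injective (resolvent_op T l),
      exists2 g : X -> X, cancel (resolvent_op T l) g &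
        exists M : R[i], forall y, range (resolvent_op T l) y -> `|g y| <= M * `|y| &
      dense (range (resolvent_op T l))].

Definition spectrum T : set R[i] := [set l | ~ regular_value T l].

End spectrum.

Section lp_sums.
Context {R : realType} (p : R).
Implicit Types (f g : nat -> R).

(* Meant for [f] nonnegative. *)
Definition lp_sum f : \bar R := (\sum_(k <oo) (f k `^ p)%:E)%E.

Lemma lp_sum_ge0 f : (0 <= lp_sum f)%E.
Proof. by apply: nneseries_ge0 => k _ _; rewrite lee_fin powR_ge0. Qed.

Lemma lp_sum_le f g : 0 < p -> (forall k, 0 <= f k <= g k) ->
  (lp_sum f <= lp_sum g)%E.
Proof.
move=> p0 fg; apply: lee_nneseries => k; first by rewrite lee_fin powR_ge0.
move=> _; have /andP[f0 fgk] := fg k.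
by rewrite lee_fin ge0_ler_powR ?nnegrE ?(ltW p0)// (le_trans f0).
Qed.

Lemma lp_sumZ c f : 0 <= c -> (forall k, 0 <= f k) ->
  lp_sum (fun k => c * f k) = ((c `^ p)%:E * lp_sum f)%E.
Proof.
move=> c0 f0; rewrite /lp_sum -nneseriesZl; last first.
  by move=> k _; rewrite lee_fin powR_ge0.
by congr (limn _); apply/funext => n; apply: eq_bigr => k _; rewrite powRM// EFinM.
Qed.

Lemma lp_sum_recl f : lp_sum f = ((f 0%N `^ p)%:E + lp_sum (fun k => f k.+1))%E.
Proof.
have h k : (0 <= (f k `^ p)%:E)%E by rewrite lee_fin powR_ge0.
rewrite /lp_sum nneseries_recl//; congr (_ + _)%E.
rewrite -(nneseries_addn 1 (f := fun k => (f k `^ p)%:E))//.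
by congr (limn _); apply/funext => n; apply: eq_bigr => k _; rewrite addn1.
Qed.

Definition lp_norm f : \bar R := (lp_sum f `^ p^-1)%E.

Lemma lp_norm_ge0 f : (0 <= lp_norm f)%E.
Proof. exact: poweR_ge0. Qed.

Lemma lp_norm_lty f : 0 < p -> (lp_norm f < +oo)%E = (lp_sum f < +oo)%E.
Proof.
move=> p0; apply/idP/idP; last exact: poweR_lty.
by apply: lty_poweRy; rewrite gt_eqF// invr_gt0.
Qed.

Lemma lp_norm_mono f g : 0 < p -> (lp_sum f <= lp_sum g)%E ->
  (lp_norm f <= lp_norm g)%E.
Proof.
move=> p0 fg; apply: gt0_ler_poweR => //; first by rewrite invr_ge0 ltW.
- by rewrite in_itv/= leey lp_sum_ge0.
- by rewrite in_itv/= leey lp_sum_ge0.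
Qed.

Lemma lp_norm_le f g : 0 < p -> (forall k, 0 <= f k <= g k) ->
  (lp_norm f <= lp_norm g)%E.
Proof. by move=> p0 fg; apply: lp_norm_mono => //; exact: lp_sum_le. Qed.

Lemma lp_normZ c f : 0 < p -> 0 <= c -> (forall k, 0 <= f k) ->
  lp_norm (fun k => c * f k) = (c%:E * lp_norm f)%E.
Proof.
move=> p0 c0 f0; rewrite /lp_norm lp_sumZ// poweRM ?lp_sum_ge0 ?lee_fin ?powR_ge0//.
by rewrite poweR_EFin -powRrM divff ?gt_eqF// powRr1.
Qed.

Lemma lp_normD f g : 1 <= p -> (forall k, 0 <= f k) -> (forall k, 0 <= g k) ->
  (lp_norm (fun k => f k + g k)%R <= lp_norm f + lp_norm g)%E.
Proof.
move=> p1 f0 g0; have p0 : 0 < p by exact: lt_le_trans p1.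
have E h : (forall k, 0 <= h k) -> lp_norm h = 'N[counting]_p%:E[EFin \o h]%E.
  move=> h0; rewrite Lnorm_counting//; congr (_ `^ _)%E.
  congr (limn _); apply/funext => n; apply: eq_bigr => k _ /=.
  by rewrite ger0_norm.
rewrite (E _ f0) (E _ g0) E => [|k]; last by rewrite addr_ge0.
exact: minkowski_EFin.
Qed.

End lp_sums.

Section sequences.
Context {R : realType} (p : R).
Implicit Types (x y : nat -> R[i]).
Import Normc.

Lemma real_normc (z : R[i]) : `|z| = (normc z)%:C.
Proof. by []. Qed.

Lemma normc_ge0 (z : R[i]) : 0 <= normc z.
Proof. by case: z => a b; exact: sqrtr_ge0. Qed.

(* Right shift: k |-> x_{k-1}, with the convention x_{-1} = 0. *)
Definition shiftr x : nat -> R[i] := fun k => if k is k'.+1 then x k' else 0.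

Definition bdiff x : nat -> R[i] := fun k => x k - shiftr x k.

Definition bv_summable x : Prop :=
  (\sum_(k <oo) (normc (x k - x k.+1) `^ p)%:E < +oo)%E.

Definition bv_norm x : R :=
  fine (\sum_(k <oo) (normc (bdiff x k) `^ p)%:E)%E `^ p^-1.

(* (U(s,r,s) x)_k = s x_{k-1} + r x_k + s x_{k+1}, with x_{-1} = 0. *)
Definition triband (s r : R[i]) x : nat -> R[i] :=
  fun k => s * shiftr x k + r * x k + s * x k.+1.

Let D x := fun k => normc (bdiff x k).

Let D_ge0 x k : 0 <= D x k. Proof. exact: normc_ge0. Qed.

Lemma bv_summableE x : 0 < p -> bv_summable x <-> (lp_norm p (D x) < +oo)%E.
Proof.
move=> p0; rewrite lp_norm_lty// lp_sum_recl /bv_summable.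
have -> : (\sum_(k <oo) (normc (x k - x k.+1) `^ p)%:E)%E =
          lp_sum p (fun k => D x k.+1).
  congr (limn _); apply/funext => n; apply: eq_bigr => k _.
  by rewrite /D /bdiff/= -normcN opprB.
split=> [h|]; first by rewrite lte_add_pinfty// ltry.
by apply: le_lt_trans; rewrite leeDr// lee_fin powR_ge0.
Qed.

Lemma bv_normE x : 0 < p -> bv_summable x -> (bv_norm x)%:E = lp_norm p (D x).
Proof.
move=> p0 /(bv_summableE _ p0); rewrite lp_norm_lty// => h.
rewrite /bv_norm -poweR_EFin fineK// ge0_fin_numE//; exact: lp_sum_ge0.
Qed.

Lemma bdiffD x y k : bdiff (x + y) k = bdiff x k + bdiff y k.
Proof. by case: k => [|k]; rewrite /bdiff/= ?subr0// opprD addrACA. Qed.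

Lemma bdiffZ a x k : bdiff (a *: x) k = a * bdiff x k.
Proof. by case: k => [|k]; rewrite /bdiff/= ?subr0// mulrBr. Qed.

Lemma bdiff_eq0 x : (forall k, bdiff x k = 0) -> x = 0.
Proof.
move=> h; apply/funext; elim=> [|k ih]; have := h _.
  by move=> /(_ 0%N); rewrite /bdiff/= subr0.
by move=> /(_ k.+1); rewrite /bdiff/= ih subr0.
Qed.

Lemma lp_bdiffD x y : 1 <= p ->
  (lp_norm p (D (x + y)%R) <= lp_norm p (D x) + lp_norm p (D y))%E.
Proof.
move=> p1; apply: le_trans (lp_normD p1 (D_ge0 x) (D_ge0 y)).
apply: lp_norm_le => [|k]; first exact: lt_le_trans p1.
by rewrite D_ge0/= /D bdiffD le_normcD.
Qed.

Lemma lp_bdiffZ a x : 0 < p ->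
  lp_norm p (D (a *: x)) = ((normc a)%:E * lp_norm p (D x))%E.
Proof.
move=> p0; rewrite -lp_normZ//; last exact: normc_ge0.
by congr (lp_norm p _); apply/funext => k; rewrite /D bdiffZ normcM.
Qed.

Lemma bv_summable0 : 0 < p -> bv_summable 0.
Proof.
move=> p0; apply/bv_summableE => //.
have -> : (0 : nat -> R[i]) = 0 *: 0 by rewrite scale0r.
by rewrite lp_bdiffZ// normc0 mul0e ltry.
Qed.

Lemma bv_summableP a x y : 1 <= p ->
  bv_summable x -> bv_summable y -> bv_summable (a *: x + y).
Proof.
move=> p1; have p0 : 0 < p by exact: lt_le_trans p1.
rewrite !bv_summableE// => hx hy; apply: le_lt_trans (lp_bdiffD _ _ p1) _.
rewrite lp_bdiffZ// lte_add_pinfty// lte_mul_pinfty ?lee_fin ?normc_ge0//.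
Qed.

Lemma bv_norm_eq0 x : 0 < p -> bv_summable x -> bv_norm x = 0 -> x = 0.
Proof.
move=> p0 bx x0; have N0 : lp_norm p (D x) = 0 by rewrite -bv_normE// x0.
have s0 := poweR_eq0_eq0 (lp_sum_ge0 p (D x)) N0.
apply: bdiff_eq0 => k.
apply: eq0_normc; apply: (@powR_eq0_eq0 _ _ p).
have : (\sum_(0 <= n < k.+1) (D x n `^ p)%:E <= lp_sum p (D x))%E.
  by apply: nneseries_lim_ge => n _ _; rewrite lee_fin powR_ge0.
rewrite s0 big_nat_recr//= => h.
apply/eqP; rewrite eq_le powR_ge0 andbT -lee_fin (le_trans _ h)//.
by rewrite leeDr// sume_ge0// => *; rewrite lee_fin powR_ge0.
Qed.

Lemma triband_is_linear s r : linear (triband s r).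
Proof.
move=> a x y; apply/funext => k; rewrite /triband/= !fctE.
have -> : shiftr (a *: x + y) k = a * shiftr x k + shiftr y k.
  by case: k => [|k] //=; rewrite mulr0 addr0.
rewrite /GRing.scale/=; ring.
Qed.

Lemma tribandE s r x :
  triband s r x = s *: shiftr x + (r *: x + s *: (fun k => x k.+1)).
Proof. by apply/funext => k; rewrite /triband addrA. Qed.

Lemma lp_bdiff_shiftr x : 0 < p -> lp_norm p (D (shiftr x)) = lp_norm p (D x).
Proof.
move=> p0; rewrite /lp_norm lp_sum_recl.
have -> : D (shiftr x) 0%N = 0 by rewrite /D /bdiff subrr normc0.
rewrite powR0 ?gt_eqF// add0e.
congr (lp_sum p _ `^ _)%E; apply/funext => -[|k] //.
Qed.

Lemma lp_bdiff_shiftl x : 1 <= p ->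
  (lp_norm p (D (fun k => x k.+1)) <= lp_norm p (D x) + lp_norm p (D x))%E.
Proof.
move=> p1; have p0 : 0 < p by exact: lt_le_trans p1.
pose e k := if k is 0%N then D x 0%N else 0.
have e0 k : 0 <= e k by case: k => [|k] //; exact: D_ge0.
pose f k := D x k.+1.
have f0 k : 0 <= f k by exact: D_ge0.
apply: (@le_trans _ _ (lp_norm p (fun k => f k + e k))).
  apply: lp_norm_le => // -[|k]; rewrite D_ge0/= /f /e ?addr0//.
  rewrite /D (_ : bdiff _ 0%N = bdiff x 1%N + bdiff x 0%N) ?le_normcD//.
  by rewrite /bdiff/= !subr0 subrK.
apply: (le_trans (lp_normD p1 f0 e0)); apply: leeD.
  apply: lp_norm_mono => //; rewrite (lp_sum_recl p (D x)).
  by rewrite leeDr// lee_fin powR_ge0.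
by apply: lp_norm_le => // k; rewrite e0/=; case: k => [|k]; rewrite ?lexx ?D_ge0.
Qed.

Lemma lp_bdiff_triband s r x : 1 <= p ->
  (lp_norm p (D (triband s r x)) <=
   (3 * normc s + normc r)%:E * lp_norm p (D x))%E.
Proof.
move=> p1; have p0 : 0 < p by exact: lt_le_trans p1.
have := lp_bdiff_shiftl x p1; set N := lp_norm p (D x) => hl.
have sr0 : (0 <= (normc s)%:E)%E by rewrite lee_fin normc_ge0.
rewrite tribandE; apply: (le_trans (lp_bdiffD _ _ p1)).
apply: (@le_trans _ _ ((normc s)%:E * N + ((normc r)%:E * N +
   (normc s)%:E * (N + N)))%E).
  apply: leeD; first by rewrite lp_bdiffZ// lp_bdiff_shiftr.
  apply: (le_trans (lp_bdiffD _ _ p1)); rewrite !lp_bdiffZ//.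
  by apply: leeD => //; exact: lee_wpmul2l.
have N0 : (0 <= N)%E by exact: lp_norm_ge0.
have r0 : (0 <= (normc r)%:E)%E by rewrite lee_fin normc_ge0.
rewrite ge0_muleDr// -!ge0_muleDl ?adde_ge0// -!EFinD lee_wpmul2r// lee_fin.
by rewrite (_ : _ + _ = 3 * normc s + normc r)//; ring.
Qed.

Lemma bv_summable_triband s r x : 1 <= p ->
  bv_summable x -> bv_summable (triband s r x).
Proof.
move=> p1; have p0 : 0 < p by exact: lt_le_trans p1.
rewrite !bv_summableE// => hx.
apply: (le_lt_trans (lp_bdiff_triband s r x p1)).
by rewrite lte_mul_pinfty// lee_fin addr_ge0 ?mulr_ge0 ?normc_ge0.
Qed.

(* Rewriting directly under [bv_norm] makes unification unfold the series. *)
Let ler_EFinM (a b c : R) (A B : \bar R) : a%:E = A -> b%:E = B ->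
  (A <= c%:E * B)%E -> a <= c * b.
Proof. by move=> <- <-; rewrite -EFinM lee_fin. Qed.

Let ler_EFinD (a b c : R) (A B C : \bar R) : a%:E = A -> b%:E = B ->
  c%:E = C -> (A <= B + C)%E -> a <= b + c.
Proof. by move=> <- <- <-; rewrite -EFinD lee_fin. Qed.

Let eq_EFinM (a b c : R) (A B : \bar R) : a%:E = A -> b%:E = B ->
  A = (c%:E * B)%E -> a = c * b.
Proof. by move=> <- <-; rewrite -EFinM => -[]. Qed.

Lemma bv_norm_triband s r x : 1 <= p -> bv_summable x ->
  bv_norm (triband s r x) <= (3 * normc s + normc r) * bv_norm x.
Proof.
move=> p1 bx; have p0 : 0 < p by exact: lt_le_trans p1.
have bU := bv_summable_triband s r p1 bx.
exact: ler_EFinM (bv_normE p0 bU) (bv_normE p0 bx) (lp_bdiff_triband s r x p1).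
Qed.

Lemma bv_norm_D x y : 1 <= p -> bv_summable x -> bv_summable y ->
  bv_norm (x + y) <= bv_norm x + bv_norm y.
Proof.
move=> p1 bx by_; have p0 : 0 < p by exact: lt_le_trans p1.
have bxy := bv_summableP 1 p1 bx by_; rewrite scale1r in bxy.
exact: ler_EFinD (bv_normE p0 bxy) (bv_normE p0 bx) (bv_normE p0 by_)
  (lp_bdiffD x y p1).
Qed.

Lemma bv_norm_Z a x : 1 <= p -> bv_summable x ->
  bv_norm (a *: x) = normc a * bv_norm x.
Proof.
move=> p1 bx; have p0 : 0 < p by exact: lt_le_trans p1.
have bax := bv_summableP a p1 bx (bv_summable0 p0); rewrite addr0 in bax.
exact: eq_EFinM (bv_normE p0 bax) (bv_normE p0 bx) (lp_bdiffZ a x p0).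
Qed.

End sequences.

(* The normed module structure requires 1 <= p, so the type carries a proof
   of 1 < p. *)
Section bv_space.
Context {R : realType} {p : R} (p1 : 1 < p).
Import Normc.

Definition bv_pred & 1 < p : {pred nat -> R[i]} :=
  fun x => `[< bv_summable p x >].

Record bv := Bv { bv_val :> nat -> R[i]; bv_valP : bv_val \in bv_pred p1 }.

Let p0 : 0 < p. Proof. exact: lt_trans p1. Qed.

Let rC_M (u v : R) : (u * v)%:C = u%:C * v%:C. Proof. by rewrite rmorphM. Qed.

HB.instance Definition _ := [isSub for bv_val].
HB.instance Definition _ := [Choice of bv by <:].

Lemma bv_submod_closed : submod_closed (bv_pred p1).
Proof.
split=> [|a x y /asboolP bx /asboolP by_]; apply/asboolP.
  exact: bv_summable0.
exact: bv_summableP (ltW p1) _ _.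
Qed.

HB.instance Definition _ :=
  GRing.isSubmodClosed.Build R[i] (nat -> R[i]) (bv_pred p1) bv_submod_closed.
HB.instance Definition _ := [SubChoice_isSubLmodule of bv by <:].

Lemma bvP (x : bv) : bv_summable p x.
Proof. by apply/asboolP; exact: bv_valP. Qed.

Definition bv_normC (x : bv) : R[i] := (bv_norm p x)%:C.

Lemma bv_normC_D (x y : bv) : bv_normC (x + y) <= bv_normC x + bv_normC y.
Proof.
by rewrite /bv_normC -rmorphD/= lecR; exact: bv_norm_D (ltW p1) (bvP x) (bvP y).
Qed.

Lemma bv_normC_Z (a : R[i]) (x : bv) : bv_normC (a *: x) = `|a| * bv_normC x.
Proof.
rewrite real_normc /bv_normC -rC_M; congr (_%:C).
exact: bv_norm_Z (ltW p1) (bvP x).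
Qed.

Lemma bv_normC_eq0 (x : bv) : bv_normC x = 0 -> x = 0.
Proof. by move=> [/(bv_norm_eq0 p0 (bvP x)) x0]; exact: val_inj. Qed.

HB.instance Definition _ := Lmodule_isNormed.Build R[i] bv
  bv_normC_D bv_normC_Z bv_normC_eq0.

Lemma bv_norm_def (x : bv) : `|x| = (bv_norm p x)%:C. Proof. by []. Qed.

Lemma triband_bvP (s r : R[i]) (x : bv) : triband s r x \in bv_pred p1.
Proof. by apply/asboolP/bv_summable_triband/bvP; exact: ltW. Qed.

Definition U (s r : R[i]) (x : bv) : bv := Bv (triband_bvP s r x).

Lemma U_is_linear s r : linear (U s r).
Proof. by move=> a x y; apply: val_inj; exact: triband_is_linear. Qed.

HB.instance Definition _ s r :=
  GRing.isLinear.Build R[i] bv bv *:%R (U s r) (U_is_linear s r).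

Lemma U_bounded s r (x : bv) : `|U s r x| <= (3 * `|s| + `|r|) * `|x|.
Proof.
have bU : bv_norm p (triband s r x) <= (3 * normc s + normc r) * bv_norm p x.
  exact: bv_norm_triband (ltW p1) (bvP x).
have E3 : 3 = (3 : R)%:C by rewrite rmorph_nat.
by rewrite -lecR rC_M rmorphD/= rC_M -E3 in bU.
Qed.

Lemma U_continuous s r : continuous (U s r : bv -> bv).
Proof.
apply/linear_bounded_continuous/linear_boundedP.
near=> M => x; apply: (le_trans (U_bounded s r x)).
apply: ler_wpM2r => //; near: M; apply: nbhs_pinfty_ge.
Unshelve. all: by end_near. Qed.

End bv_space.

Arguments U {R p} p1 s r x.

(* Main.v *)
(* For s <> 0 write l = r + s (q + 1/q) with q <> 0 and |q| <= 1; since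
   B S = 1 for the left and right shifts B and S,
     U(s,r,s) - l = -(s/q) (1 - q B) (1 - q S).
   On bv_p one has |S^n| = 1 and |B^n| <= n + 1, so if |q| < 1 the powers of
   q B and q S tend to 0 in norm, and finite Neumann sums show that 1 - q B and
   1 - q S are bounded below with dense range (completeness is not needed).
   If |q| = 1, i.e. q + 1/q = 2 cos t, let e be the constant sequence 1; then
   x_n = sum_(k < n) (q S)^k e has norm n^(1/p), while
   (1 - q S) x_n = e - (q S)^n e has norm at most 2, so U(s,r,s) - l is not
   bounded below. *)
From HB Require Import structures.
Require Import Defs.
From mathcomp Require Import all_boot all_order all_algebra.
From mathcomp Require Import all_classical all_reals all_analysis.
From mathcomp Require Import complex ring lra.

Import Order.TTheory GRing.Theory Num.Theory.
Import numFieldNormedType.Exports.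

Local Open Scope classical_set_scope.
Local Open Scope ring_scope.
Local Open Scope complex_scope.

(** * Lower bounds, dense ranges and finite Neumann sums *)

Section neumann.
Context {K : numFieldType} {X : normedModType K}.
Implicit Types (f g : X -> X) (x y w : X).

Definition bounded_below (f : X -> X) : Prop :=
  exists2 C : K, 0 <= C & forall x, `|x| <= C * `|f x|.

Lemma denseP (E : set X) :
  dense E <-> forall w e, 0 < e -> exists2 y, E y & `|w - y| < e.
Proof.
split=> [dE w e e0|h O [w Ow] oO].
  have [||y [/interior_subset]] := dE (ball w e)°.
  - by exists w; apply: nbhsx_ballx.
  - exact: open_interior.
  - by rewrite -ball_normE => wy Ey; exists y.
have /nbhs_normP[e /= e0 eO] : nbhs w O by exact: open_nbhs_nbhs.
by have [y Ey wy] := h w e e0; exists y; split => //; exact: eO.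
Qed.

Lemma bounded_below_comp f g :
  bounded_below f -> bounded_below g -> bounded_below (f \o g).
Proof.
move=> [C C0 hf] [D D0 hg]; exists (D * C); first exact: mulr_ge0.
by move=> x; rewrite (le_trans (hg x))// -mulrA ler_wpM2l// hf.
Qed.

Lemma bounded_belowZ a : a != 0 -> bounded_below ( *:%R a).
Proof.
move=> a0; exists `|a|^-1; first by rewrite invr_ge0.
by move=> x; rewrite normrZ mulKf// normr_eq0.
Qed.

Lemma dense_range_comp f g : continuous f ->
  dense (range f) -> dense (range g) -> dense (range (f \o g)).
Proof.
move=> cf df dg O O0 oO.
have [z [Oz [y _ fy]]] := df O O0 oO.
have [||v [Ofv [x _ gx]]] := dg (f @^-1` O).
- by exists y; rewrite /preimage/= fy.
- by move/continuousP : cf; apply.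
by exists (f v); split => //; exists x => //=; rewrite gx.
Qed.

Lemma dense_rangeZ a : a != 0 -> dense (range ( *:%R a : X -> X)).
Proof.
move=> a0 O [w Ow] _; exists w; split => //.
by exists (a^-1 *: w) => //; rewrite scalerA divff// scale1r.
Qed.

(** A telescoping sum: up to [A^n], the partial Neumann sum is a left inverse of [1 - A], which
    yields lower bounds. The right-sided version that follows exhibits points of the range. *)
Lemma sum_iterB (A : {linear X -> X}) n x :
  \sum_(k < n) iter k A (x - A x) = x - iter n A x.
Proof.
elim: n => [|n IH]; first by rewrite big_ord0 subrr.
rewrite big_ord_recr/= IH.
have -> : iter n A (x - A x) = iter n A x - iter n A (A x).
  by elim: n {IH} => //= n ->; rewrite linearB.
by rewrite -iterSr iterS addrA subrK.
Qed.

Lemma sum_iterE (A : {linear X -> X}) n x :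
  \sum_(k < n) iter k A x - A (\sum_(k < n) iter k A x) = x - iter n A x.
Proof.
elim: n => [|n IH]; first by rewrite big_ord0 linear0 !subrr.
rewrite big_ord_recr/= linearD opprD addrACA IH -!addrA; congr (_ + _).
by rewrite addrA addNr add0r.
Qed.

Lemma bounded_linear_continuous (A : {linear X -> X}) (C : K) : 0 <= C ->
  (forall x, `|A x| <= C * `|x|) -> continuous A.
Proof.
move=> C0 hA; apply/linear_bounded_continuous/linear_boundedP.
near=> M => x; rewrite (le_trans (hA x))// ler_wpM2r//.
near: M; apply: nbhs_pinfty_ge; exact: ger0_real.
Unshelve. all: by end_near. Qed.

Context (A : {linear X -> X}) (u : nat -> K).
Hypothesis Au : forall n x, `|iter n A x| <= u n * `|x|.
Hypothesis u0 : forall e, 0 < e -> exists n, u n < e.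

(** Choose [N] with [u N < 1/2]. In [x = sum_(k < N) A^k (x - A x) + A^N x] the last term has norm
    at most half of [|x|] and is absorbed on the left. *)
Lemma bounded_below_neumann : bounded_below (fun x => x - A x).
Proof.
have [|N uN] := u0 2^-1; first by rewrite invr_gt0.
(* The zero space is treated apart: a nonzero vector is what forces the weights [u n] to be
   nonnegative. *)
have [X0|] := pselect (forall x : X, x = 0).
  by exists 0 => // x; rewrite (X0 x) normr0 mul0r.
move=> /existsNP[x0 /eqP x0N0]; have x0p : 0 < `|x0| by rewrite normr_gt0.
have ug n : 0 <= u n.
  by rewrite -(pmulr_lge0 _ x0p) (le_trans _ (Au n x0)).
exists (2 * \sum_(k < N) u k); first by rewrite mulr_ge0// sumr_ge0.
move=> x; set w := x - A x.
have h : `|x| <= (\sum_(k < N) u k) * `|w| + 2^-1 * `|x|.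
  rewrite -{1}(subrK (iter N A x) x) -sum_iterB (le_trans (ler_normD _ _))//.
  rewrite lerD//.
    rewrite (le_trans (ler_norm_sum _ _ _))// mulr_suml.
    by apply: ler_sum => k _; exact: Au.
  by rewrite (le_trans (Au _ _))// ler_wpM2r// ltW.
have -> : `|x| = 2 * (`|x| - 2^-1 * `|x|).
  by rewrite mulrBr mulrA divff// mul1r mulr2n mulrDl !mul1r addrK.
by rewrite -mulrA ler_wpM2l// lerBlDr.
Qed.

(** The point [w - A^n w] lies in the range, at distance at most [u n * |w|] from [w]. *)
Lemma dense_range_neumann : dense (range (fun x => x - A x)).
Proof.
apply/denseP => w e e0.
(* Adding 1 keeps the denominator positive when [w = 0]. *)
have w1 : 0 < `|w| + 1 by rewrite ltr_wpDl.
have [|n un] := u0 (e / (`|w| + 1)); first by rewrite divr_gt0.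
exists (\sum_(k < n) iter k A w - A (\sum_(k < n) iter k A w)).
  by exists (\sum_(k < n) iter k A w).
rewrite sum_iterE subKr; apply: (le_lt_trans (Au n w)).
apply: (@le_lt_trans _ _ (e / (`|w| + 1) * `|w|)).
  by rewrite ler_wpM2r// ltW.
by rewrite -mulrA gtr_pMr// ltr_pdivrMl// mulr1 ltrDl.
Qed.

End neumann.

(** * Regular values through lower bounds and dense range *)

Section regular_values.
Context {R : realType} {X : normedModType R[i]}.
Implicit Types (T : {linear X -> X}) (l : R[i]).

Lemma regular_value_bounded_below T l :
  regular_value T l -> bounded_below (resolvent_op T l).
Proof.
(* [M] is only a complex scalar, but [M * |T x - l x|] dominates [|x|], hence is nonnegative and
   equal to its own modulus. *)
move=> [_ [g gK [M hM]] _]; exists `|M| => // x.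
have := hM _ (imageT (resolvent_op T l) x); rewrite gK => h.
have /ger0_norm : 0 <= M * `|resolvent_op T l x| by exact: le_trans h.
by rewrite normrM normr_id => ->.
Qed.

Lemma regular_valueP T l : bounded_below (resolvent_op T l) ->
  dense (range (resolvent_op T l)) -> regular_value T l.
Proof.
move=> [C C0 hC] d.
have inj : injective (resolvent_op T l).
  move=> x y /eqP; rewrite -subr_eq0 => /eqP xy; apply/eqP.
  rewrite -subr_eq0 -normr_le0 (le_trans (hC _))//.
  suff -> : resolvent_op T l (x - y) = 0 by rewrite normr0 mulr0.
  by rewrite -xy /resolvent_op linearB scalerBr !opprD addrACA.
(* The inverse is obtained by choice, with default value 0 off the range. *)
pose g y := xget 0 [set x | resolvent_op T l x = y].
have gK : cancel (resolvent_op T l) g.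
  by move=> x; rewrite /g; case: xgetP => [y _ /inj//|/(_ x)]; case.
split => //; exists g => //; exists C => _ [x _ <-].
by rewrite gK.
Qed.

End regular_values.

(** * The two shifts on [bv_p] and the factorization of the operator *)

Section shifts.
Context {R : realType} {p : R} (p1 : 1 < p).
Import Normc.
Local Notation X := (bv p1).

Let p0 : 0 < p. Proof. exact: lt_trans p1. Qed.
Let p1w : 1 <= p. Proof. exact: ltW. Qed.

Lemma ler_bv_norm (x y : X) :
  (lp_norm p (fun k => normc (bdiff x k)) <=
   lp_norm p (fun k => normc (bdiff y k)))%E -> `|x| <= `|y|.
Proof.
have := bv_normE p0 (bvP x); have := bv_normE p0 (bvP y) => <- <-.
by rewrite lee_fin !bv_norm_def lecR.
Qed.

Lemma shiftr_bvP (x : X) : shiftr x \in bv_pred p1.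
Proof.
by apply/asboolP/bv_summableE => //; rewrite lp_bdiff_shiftr//; apply/bv_summableE/bvP.
Qed.

Definition bv_shiftr (x : X) : X := Bv (shiftr_bvP x).

Lemma bv_shiftr_is_linear : linear bv_shiftr.
Proof.
move=> a x y; apply/val_inj/funext => -[|k] //=.
by rewrite !fctE/= scaler0 addr0.
Qed.

HB.instance Definition _ :=
  GRing.isLinear.Build R[i] X X *:%R bv_shiftr bv_shiftr_is_linear.

Lemma norm_bv_shiftr x : `|bv_shiftr x| = `|x|.
Proof.
by apply/le_anti/andP; split; apply: ler_bv_norm;
  [rewrite [leLHS](lp_bdiff_shiftr x p0)|rewrite [leRHS](lp_bdiff_shiftr x p0)].
Qed.

Lemma shiftl_bvP (x : X) : (fun k => x k.+1) \in bv_pred p1.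
Proof.
apply/asboolP/bv_summableE => //; apply: le_lt_trans (lp_bdiff_shiftl _ p1w) _.
by apply: lte_add_pinfty; apply/bv_summableE/bvP.
Qed.

Definition bv_shiftl (x : X) : X := Bv (shiftl_bvP x).

Lemma bv_shiftl_is_linear : linear bv_shiftl.
Proof. by move=> a x y; apply/val_inj/funext. Qed.

HB.instance Definition _ :=
  GRing.isLinear.Build R[i] X X *:%R bv_shiftl bv_shiftl_is_linear.

Lemma bdiff_cst1 k : bdiff (fun=> 1 : R[i]) k = (k == 0%N)%:R.
Proof. by case: k => [|k]; rewrite /bdiff/= ?subr0 ?subrr. Qed.

Lemma lp_sum_cst1 : lp_sum p (fun k => normc (bdiff (fun=> 1 : R[i]) k)) = 1%E.
Proof.
rewrite lp_sum_recl bdiff_cst1 normc1 powR1 /lp_sum eseries0 ?adde0// => k _ _.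
by rewrite bdiff_cst1 normc0 powR0// gt_eqF.
Qed.

Lemma cst1_bvP : (fun=> 1) \in bv_pred p1.
Proof.
by apply/asboolP/bv_summableE => //; rewrite lp_norm_lty// lp_sum_cst1 ltry.
Qed.

Definition bv_cst1 : X := Bv cst1_bvP.

Lemma bv_norm_powR (x : X) :
  `|x| = ((fine (lp_sum p (fun k => normc (bdiff x k)))) `^ p^-1)%:C.
Proof. by []. Qed.

Lemma norm_bv_cst1 : `|bv_cst1| = 1.
Proof. by rewrite bv_norm_powR lp_sum_cst1 powR1. Qed.

(** The value [x 0] is the first backward difference, so its [p]-th power is one term of the series
    defining the norm. *)
Lemma norm_bv_coord0 (x : X) : `|x 0%N| <= `|x|.
Proof.
rewrite bv_norm_def real_normc lecR -lee_fin.
have /= -> := bv_normE p0 (bvP x).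
have -> : (normc (x 0%N))%:E = (((normc (x 0%N) `^ p)%:E) `^ p^-1)%E.
  by rewrite poweR_EFin -powRrM divff ?gt_eqF// powRr1// normc_ge0.
apply: gt0_ler_poweR;
  rewrite ?invr_ge0 ?in_itv/= ?leey ?andbT ?lee_fin ?powR_ge0 ?(ltW p0)//.
  exact: lp_sum_ge0.
by rewrite lp_sum_recl /bdiff/= subr0 leeDl// lp_sum_ge0.
Qed.

(* Acts on the differences [bdiff x] as the left shift, hence is a contraction. *)
Definition bv_dshiftl (x : X) : X := bv_shiftl x - x 0%N *: bv_cst1.

Lemma norm_bv_dshiftl x : `|bv_dshiftl x| <= `|x|.
Proof.
apply: ler_bv_norm; apply: lp_norm_mono => //.
rewrite [leRHS]lp_sum_recl.
rewrite (_ : (fun k => normc (bdiff (bv_dshiftl x) k)) =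
  (fun k => normc (bdiff x k.+1))); first by rewrite leeDr// lee_fin powR_ge0.
apply/funext => -[|k]; rewrite /bdiff/= !fctE/= ?subr0 /GRing.scale/= ?mulr1//.
by rewrite opprD addrACA -opprD subrr subr0.
Qed.

(** Writing [e] for the constant sequence 1, [B x] is [bv_dshiftl x + x 0 *: e]. The first summand
    is no longer than [x], and [B] fixes [e], so each further power adds at most [|x 0| <= |x|]. *)
Lemma norm_iter_bv_shiftl n x : `|iter n bv_shiftl x| <= n.+1%:R * `|x|.
Proof.
elim: n x => [|n IH] x; first by rewrite mul1r.
have it1 : iter n bv_shiftl bv_cst1 = bv_cst1.
  by elim: n {IH} => //= n ->; exact: val_inj.
have itD a b c : iter n bv_shiftl (a + b *: c) =
    iter n bv_shiftl a + b *: iter n bv_shiftl c.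
  by elim: n {IH it1} => //= n ->; rewrite linearD linearZ.
rewrite iterSr -(subrK (x 0%N *: bv_cst1) (bv_shiftl x)) itD it1.
apply: (le_trans (ler_normD _ _)).
rewrite -[in leRHS](addn1 n.+1) natrD mulrDl mul1r; apply: lerD.
  apply: (le_trans (IH _)); apply: ler_wpM2l; first exact: ler0n.
  exact: norm_bv_dshiftl.
by rewrite normrZ norm_bv_cst1 mulr1; exact: norm_bv_coord0.
Qed.

(** The order of the factors matters: shifting right and then left is the identity, whereas the
    reverse order erases coordinate 0. *)
Lemma triband_factor (r s q : R[i]) (x : X) : q != 0 ->
  resolvent_op (U p1 s r) (r + s * (q + q^-1)) x =
  (- (s / q)) *: (let y := x - q *: bv_shiftr x in y - q *: bv_shiftl y).
Proof.
move=> q0; apply/val_inj/funext => k; rewrite /resolvent_op /= /triband.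
rewrite !fctE /GRing.scale /= /GRing.scale/=.
by case: k => [|k] /=; field.
Qed.

End shifts.

(** * Decay of the weights [(n + 1) c^n] *)

Section spectrum_triband.
Context {R : realType} {p : R} (p1 : 1 < p).
Import Normc.
Local Notation X := (bv p1).

Lemma natSexpr_to0 (c : R) : 0 <= c < 1 ->
  forall e : R[i], 0 < e -> exists n, n.+1%:R * c%:C ^+ n < e.
Proof.
move=> /andP[c0 c1] e e0.
(* Positive in [R[i]] means real and positive, so the estimate takes place in [R]. *)
have eE : e = (complex.Re e)%:C by rewrite RRe_real// ger0_real// ltW.
rewrite eE ltcR in e0.
(* With [d = sqrt c], [(n+1) d^n <= 1 + d + ... + d^n <= 1 / (1 - d)]. *)
pose d := Num.sqrt c; have d0 : 0 <= d by exact: sqrtr_ge0.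
have d1 : d < 1 by rewrite -sqrtr1 ltr_sqrt.
have dc n : c ^+ n = d ^+ n * d ^+ n by rewrite -exprMn -expr2 sqr_sqrtr.
have bern n : n.+1%:R * (1 - d) * d ^+ n <= 1 - d ^+ n.+1.
  elim: n => [|n IH]; first by rewrite mul1r expr0 mulr1 expr1.
  have := ler_wpM2l d0 IH; have : d ^+ n.+1 <= 1 by rewrite exprn_ile1// ltW.
  rewrite -natr1 [d ^+ n.+2]exprS.
  rewrite exprS; set D := d ^+ n; move=> h1 h2; nra.
have /cvgr0Pnorm_lt h : (GRing.exp d : R^nat) @ \oo --> 0.
  by apply: cvg_expr; rewrite ger0_norm.
have d1' : 0 < 1 - d by rewrite subr_gt0.
have [|N _ /(_ N (leqnn N))/= hN] := h (complex.Re e * (1 - d)); first exact: mulr_gt0.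
rewrite ger0_norm ?exprn_ge0// in hN.
exists N; rewrite eE -rmorphXn/= -(rmorph_nat (@real_complex R)) -rmorphM/= ltcR.
rewrite dc mulrA -(ltr_pM2l d1').
apply: le_lt_trans (_ : d ^+ N < _); last by rewrite mulrC.
have dN := exprn_ge0 N d0.
have : N.+1%:R * (1 - d) * d ^+ N <= 1.
  by rewrite (le_trans (bern N))// gerBl exprn_ge0.
move=> /(ler_wpM2r dN); rewrite mul1r; apply: le_trans.
by rewrite le_eqVlt; apply/orP; left; apply/eqP; ring.
Qed.

Lemma iter_scale_linear (A : {linear X -> X}) (q : R[i]) n x :
  iter n (q \*: A) x = q ^+ n *: iter n A x.
Proof.
elim: n => [|n IH] /=; first by rewrite expr0 scale1r.
by rewrite IH linearZ scalerA -exprS.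
Qed.

(** * Parameters [q] inside the unit disc *)

Section inside.
Context (q : R[i]) (q1 : `|q| < 1).

Let c01 : 0 <= normc q < 1.
Proof. by rewrite normc_ge0/=; move: q1; rewrite real_normc ltcR. Qed.

Lemma norm_iter_scale_shiftl n x :
  `|iter n (q \*: bv_shiftl p1) x| <= n.+1%:R * (normc q)%:C ^+ n * `|x|.
Proof.
rewrite iter_scale_linear normrZ normrX real_normc [leRHS]mulrAC [leRHS]mulrC.
by apply: ler_wpM2l (norm_iter_bv_shiftl _ _ _); rewrite exprn_ge0// -real_normc.
Qed.

Lemma norm_iter_shiftr n (x : X) : `|iter n (bv_shiftr p1) x| = `|x|.
Proof. by elim: n => [|n <-]; [reflexivity|exact: norm_bv_shiftr]. Qed.

(** The right shift is isometric, so [|q|^n] already bounds the power; the weight of the left shift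
    is kept so that one limit serves both factors. *)
Lemma norm_iter_scale_shiftr n x :
  `|iter n (q \*: bv_shiftr p1) x| <= n.+1%:R * (normc q)%:C ^+ n * `|x|.
Proof.
rewrite iter_scale_linear normrZ normrX real_normc norm_iter_shiftr.
apply: ler_wpM2r; first exact: normr_ge0.
by apply: ler_peMl; [rewrite exprn_ge0// -real_normc|rewrite ler1n].
Qed.

Lemma regular_value_triband (r s : R[i]) : s != 0 -> q != 0 ->
  regular_value (U p1 s r) (r + s * (q + q^-1)).
Proof.
move=> s0 q0.
have TE : resolvent_op (U p1 s r) (r + s * (q + q^-1)) =
    *:%R (- (s / q)) \o ((fun y => y - (q \*: bv_shiftl p1) y) \o
      (fun x => x - (q \*: bv_shiftr p1) x)).
  by apply/funext => x; rewrite triband_factor.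
have sq0 : - (s / q) != 0 by rewrite oppr_eq0 mulf_neq0// invr_eq0.
have u0 := natSexpr_to0 _ c01.
apply: regular_valueP; rewrite TE.
  apply: bounded_below_comp; first exact: bounded_belowZ.
  apply: bounded_below_comp.
    exact: bounded_below_neumann norm_iter_scale_shiftl u0.
  exact: bounded_below_neumann norm_iter_scale_shiftr u0.
apply: dense_range_comp.
- exact: scaler_continuous.
- exact: dense_rangeZ.
apply: dense_range_comp.
- have c : continuous (q \*: bv_shiftl p1 : X -> X).
    apply: bounded_linear_continuous (norm_iter_scale_shiftl 1).
    by rewrite mulr_ge0// exprn_ge0// -real_normc.
  by move=> x; apply: continuousB; [exact: cvg_id|exact: c].
- exact: dense_range_neumann norm_iter_scale_shiftl u0.
- exact: dense_range_neumann norm_iter_scale_shiftr u0.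
Qed.

End inside.

(** * Parameters [q] on the unit circle *)

Section circle.
Context (q : R[i]) (q1 : `|q| = 1).
Let F : {linear X -> X} := q \*: bv_shiftr p1.
Let wave n : X := \sum_(k < n) iter k F (bv_cst1 p1).

(** The differences of [wave n] are [q^k] for [k < n] and 0 afterwards: exactly [n] of them have
    modulus 1. *)
Lemma lp_sum_wave n :
  lp_sum p (fun k => normc (bdiff (wave n) k)) = n%:R%:E.
Proof.
have p0 : 0 < p by exact: lt_trans p1.
elim: n => [|n IH].
  rewrite /wave big_ord0 /lp_sum eseries0// => k _ _.
  have -> : bdiff (0 : X) k = 0 by case: k => [|k]; exact: subrr.
  by rewrite normc0 powR0// gt_eqF.
(* In terms of differences, this recursion prepends a 1 to [q] times the differences of [wave n]. *)
have E : wave n.+1 = bv_cst1 p1 + F (wave n).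
  by rewrite /wave big_ord_recl linear_sum.
rewrite lp_sum_recl E.
rewrite (_ : (fun k => _) = (fun k => normc (bdiff (wave n) k))); last first.
  apply/funext => k; rewrite -[RHS]mul1r.
  have -> : 1 = normc q by move: q1; rewrite real_normc => -[].
  rewrite -normcM; congr normc; rewrite /bdiff/= /F !fctE/= /GRing.scale/=.
  by case: k => [|k] /=; ring.
rewrite IH /bdiff/= /F !fctE/= /GRing.scale/= mulr0 addr0 subr0 normc1 powR1.
by rewrite -EFinD -natr1 addrC.
Qed.

Lemma not_regular_value_triband (r s : R[i]) :
  ~ regular_value (U p1 s r) (r + s * (q + q^-1)).
Proof.
have q0 : q != 0 by rewrite -normr_eq0 q1 oner_eq0.
move=> /regular_value_bounded_below[C C0 hC].
(* The factor 2 bounds [(1 - q S) (wave n) = e - (q S)^n e]; the factor 3 bounds [1 - q B], since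
   [B] at most doubles the norm. *)
have bound n : `|wave n| <= C * (`|s| * (3 * 2)).
  apply: (le_trans (hC _)); apply: ler_wpM2l => //.
  rewrite triband_factor// normrZ normrN normrM normfV q1 invr1 mulr1.
  apply: ler_wpM2l => //=.
  have -> : wave n - q *: bv_shiftr p1 (wave n) =
      bv_cst1 p1 - iter n F (bv_cst1 p1) by exact: sum_iterE.
  set y := bv_cst1 p1 - iter n F (bv_cst1 p1).
  have y2 : `|y| <= 2.
    apply: (le_trans (ler_normB _ _)).
    rewrite iter_scale_linear normrZ normrX q1 expr1n mul1r norm_iter_shiftr.
    by rewrite norm_bv_cst1.
  apply: (@le_trans _ _ (3 * `|y|)); last exact: ler_wpM2l.
  apply: (le_trans (ler_normB _ _)); rewrite normrZ q1 mul1r.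
  have h : `|bv_shiftl p1 y| <= 2 * `|y| := norm_iter_bv_shiftl p1 1 y.
  have -> : 3 * `|y| = `|y| + 2 * `|y| by rewrite -[3]nat1r mulrDl mul1r.
  exact: lerD (lexx _) h.
pose M := complex.Re (C * (`|s| * (3 * 2))).
have ME : C * (`|s| * (3 * 2)) = M%:C.
  by rewrite RRe_real// ger0_real// !mulr_ge0.
have p0 : 0 < p by exact: lt_trans p1.
(* Since [wave n] has norm [n^(1/p)], the uniform bound caps every natural number by [M^p], against
   the Archimedean property. *)
have nM n : n%:R <= M `^ p.
  have := bound n; rewrite ME bv_norm_powR lp_sum_wave lecR/= => h.
  have := ge0_ler_powR (ltW p0) _ _ h; rewrite !nnegrE powR_ge0.
  rewrite (le_trans (powR_ge0 _ _) h) -powRrM mulVf ?gt_eqF// powRr1// => -> //.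
by have := nM (Num.bound (M `^ p)); rewrite leNgt archi_boundP// powR_ge0.
Qed.

End circle.
End spectrum_triband.

(** * The map [q + 1/q] and its values on the unit circle *)

Section joukowski.
Context {R : realType}.
Implicit Types (q m : R[i]).

(** The roots of [q^2 - m q + 1] have product 1 and sum [m], so they are [q] and [1/q], and one of
    them lies in the closed unit disc. *)
Lemma joukowski_surj m : exists q, [/\ q != 0, `|q| <= 1 & m = q + q^-1].
Proof.
pose q := (m + sqrtc (m ^+ 2 - 4)) / 2.
have qE : q * (m - q) = 1.
  have := sqr_sqrtc (m ^+ 2 - 4); rewrite /q; set t := sqrtc _ => tE.
  have -> : (m + t) / 2 * (m - (m + t) / 2) = (m ^+ 2 - t ^+ 2) / 4 by field.
  by rewrite tE; field.
have q0 : q != 0.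
  by apply: contra_eq_neq qE => ->; rewrite mul0r eq_sym oner_neq0.
have mE : m = q + q^-1.
  by rewrite -[X in _ + X](mulr1) -qE mulKf// addrC subrK.
(* The order on [R[i]] is partial, so the case split is made on the real number underlying [|q|]. *)
have [q1|q1] := lerP (complex.Re `|q|) 1.
  by exists q; split => //; rewrite -[`|q|]RRe_real ?normr_real// lecR.
exists q^-1; split; [by rewrite invr_eq0| |by rewrite invrK addrC].
rewrite normfV invf_le1 ?normr_gt0//.
by rewrite -[`|q|]RRe_real ?normr_real// lecR ltW.
Qed.

Lemma unit_addV q : `|q| = 1 -> q + q^-1 = 2 * (complex.Re q)%:C.
Proof. by move=> q1; rewrite invc_norm q1 expr1n invr1 mul1r addcJ. Qed.

(** Passes between unit parameters and angles: [acos] supplies an angle in [[0, pi]], and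
    [cos t + i sin t] a point of the circle. *)
Lemma unit_ReP (a : R) :
  (exists2 q, `|q| = 1 & complex.Re q = a) <->
  (exists2 t, t \in `[0, 2 * pi] & cos t = a).
Proof.
split=> [[q q1 <-]|[t _ <-]].
  have /andP[q1l q1r] : -1 <= complex.Re q <= 1.
    rewrite -ler_norml -(ler_sqr) ?nnegrE// real_normK ?num_real// expr1n.
    move: q1; rewrite normc_def => -[/(congr1 (fun x => x ^+ 2))].
    by rewrite expr1n sqr_sqrtr ?addr_ge0 ?sqr_ge0// => <-; rewrite lerDl sqr_ge0.
  have [t0 tpi] : 0 <= acos (complex.Re q) <= pi /\
      cos (acos (complex.Re q)) = complex.Re q.
    by apply: acos_def; rewrite q1l.
  exists (acos (complex.Re q)) => //; rewrite in_itv/=.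
  by case/andP : t0 => -> h /=; rewrite (le_trans h)// ler_peMl ?pi_ge0// ler1n.
by exists (cos t +i* sin t) => //; rewrite normc_def/= cos2Dsin2 sqrtr1.
Qed.

End joukowski.

Theorem theorem4p2 (R : realType) (p : R) (p1 : 1 < p) (r s : R[i]) :
  spectrum (U p1 s r) =
  [set r + 2 * s * (cos theta)%:C | theta in `[0, 2 * pi]].
Proof.
apply/seteqP; split=> [l lU|_ [t t2 <-]]; last first.
  (* With [cos t] the real part of a unit [q], [2 cos t] is [q + 1/q]. *)
  have [|q q1 <-] := (unit_ReP (cos t)).2; first by exists t.
  rewrite (_ : 2 * s * _ = s * (q + q^-1)); first exact: not_regular_value_triband.
  by rewrite unit_addV// mulrCA mulrA.
(* For [s = 0] the segment shrinks to [r] and the operator minus [l] is the scalar [r - l]; for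
   [s != 0] the parameter [q] comes from [(l - r) / s]. *)
have [s0|s0] := eqVneq s 0.
  have UE : resolvent_op (U p1 s r) l = *:%R (r - l).
    apply/funext => x; apply/val_inj/funext => k.
    rewrite s0 /resolvent_op/= /triband !fctE /GRing.scale/= /GRing.scale/=.
    ring.
  have [rl|rl] := eqVneq r l.
    exists 0; first by rewrite /= in_itv/= lexx mulr_ge0// pi_ge0.
    by rewrite s0 mulr0 mul0r addr0.
  have rl0 : r - l != 0 by rewrite subr_eq0.
  exfalso; apply: lU; apply: regular_valueP; rewrite UE.
    exact: bounded_belowZ.
  exact: dense_rangeZ.
have [q [q0 q1 mE]] := joukowski_surj ((l - r) / s).
have lE : l = r + s * (q + q^-1) by rewrite -mE mulrCA divff// mulr1 addrC subrK.
(* A parameter strictly inside the disc would make [l] a regular value. *)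
have {}q1 : `|q| = 1.
  apply/eqP; rewrite eq_le q1/=; apply/negPn/negP => q1'.
  apply: lU; rewrite lE; apply: regular_value_triband => //.
  by rewrite lt_def q1 andbT; apply: contra q1' => /eqP <-.
have [|t t2 tE] := (unit_ReP (complex.Re q)).1; first by exists q.
by exists t => //; rewrite tE lE unit_addV// mulrCA mulrA.
Qed.
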